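(* Let $p\geq q>0$ and let $a_n,\lambda_n>0$ for every $n=1,2,\ldots$. Put $\Lambda_n=\sum_{i=1}^n\lambda_i$ and $A_n=\sum_{i=1}^n\lambda_i a_i$. Then for every integer $N\geq 1$, $$\sum_{n=1}^N\lambda_n\left(\frac{A_n}{\Lambda_n}\right)^{-p} \;\leq\; \left(\frac{p+1}{p}\right)^q\sum_{n=1}^N\lambda_n\left(\frac{A_n}{\Lambda_n}\right)^{-p+q}a_n^{-q} \;-\; \frac{q}{p+1}\,\Lambda_N\left(\frac{A_N}{\Lambda_N}\right)^{-p}.$$
   Context: All sequences are real; $p,q$ are real numbers. *)

(* Defs.v *)
From mathcomp Require Import all_boot all_order all_algebra.
From mathcomp Require Import reals.

Set Implicit Arguments.
Unset Strict Implicit.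
Unset Printing Implicit Defensive.

Local Open Scope ring_scope.

(* Sequences are indexed from 1; the value at index 0 is never used. *)

Definition Lambda (R : realType) (lam : nat -> R) (n : nat) : R :=
  \sum_(1 <= i < n.+1) lam i.

Definition wA (R : realType) (lam a : nat -> R) (n : nat) : R :=
  \sum_(1 <= i < n.+1) lam i * a i.

(* Main.v *)
Require Import Defs.
From mathcomp Require Import all_boot all_order all_algebra.
From mathcomp Require Import reals exp.
From mathcomp Require Import sequences ring lra.

Import Order.TTheory GRing.Theory Num.Theory.

(** Write [x n = A n / Lambda n] for the weighted means. The inequality
    telescopes: it is the sum over [n] of

      [lam n * x n ^ -p <= ((p+1)/p)^q * lam n * x n ^ (-p+q) * a n ^ -q
         - q/(p+1) * (Lambda n * x n ^ -p - Lambda n.-1 * x n.-1 ^ -p)],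

    and each summand ([weighted_mean_step]) follows from two uses of one fact,
    that the convex function [y |-> y ^ -p] lies above its tangent lines
    ([powRN_tangent]).

    The exponent [-q], with [a n] compared to [(p+1)/p * x n], bounds the term
    containing [a n ^ -q] below by an expression linear in [a n]. Since
    [lam n * a n = Lambda n * x n - Lambda n.-1 * x n.-1], that expression
    involves only the means. The exponent [-p], with [x n.-1] compared to
    [x n], then absorbs the mixed term [x n.-1 * x n ^ (-p-1)]. The ratio
    [a n / x n = (p+1)/p] is the asymptotic one for [lam n = 1] and
    [a n = n ^ (1/p)], the borderline case where the sum of the [x n ^ -p]
    diverges like the harmonic series. *)

Local Open Scope ring_scope.

(** The tangent is taken at [x]. After scaling to [x = 1] this is
    [1 - p * (s - 1) <= expR (- p * ln s)], which chains the two tangent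
    bounds [1 + t <= expR t] and [ln s <= s - 1]. *)
Lemma powRN_tangent (R : realType) (p x y : R) : 0 <= p -> 0 < x -> 0 < y ->
  x `^ (- p) * (1 + p - p * (y / x)) <= y `^ (- p).
Proof.
move=> p0 x0 y0; set s := y / x.
have s0 : 0 < s by rewrite divr_gt0.
have -> : y = x * s by rewrite /s mulrC divfK // gt_eqF.
rewrite powRM ?(ltW x0) ?(ltW s0) // ler_pM2l ?powR_gt0 //.
have ln_le : ln s <= s - 1.
  by rewrite -{1}(subrK 1 s) addrC le_ln1Dx //; lra.
rewrite /powR gt_eqF //; apply: le_trans (expR_ge1Dx _).
by have := ler_wpM2l p0 ln_le; lra.
Qed.

(** Here [L], [l], [x], [y] stand for [Lambda n], [lam n.+1] and the means of
    index [n.+1] and [n]. Positivity of [y] is only asked when [L > 0], so that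
    the empty mean [n = 0] is covered. *)
Lemma weighted_mean_step (R : realType) (p q x y a L l : R) :
  0 < p -> 0 < q -> 0 < x -> 0 < a -> 0 <= L -> 0 < l ->
  (0 < L -> 0 < y) -> (L + l) * x = L * y + l * a ->
  l * x `^ (- p) <= ((p + 1) / p) `^ q * (l * x `^ (- p + q) * a `^ (- q))
    - q / (p + 1) * ((L + l) * x `^ (- p) - L * y `^ (- p)).
Proof.
move=> p0 q0 x0 a0 L0 l0 y0 mean.
have p1 : 0 < p + 1 by lra.
have c0 : 0 < (p + 1) / p by rewrite divr_gt0.
set X := x `^ (- p); set Y := y `^ (- p); set c := (p + 1) / p.
have a_tangent : X * (1 + q - q * (a / (c * x)))
    <= c `^ q * (x `^ (- p + q) * a `^ (- q)).
  have := powRN_tangent R q (c * x) a (ltW q0) (mulr_gt0 c0 x0) a0.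
  have cx : 0 <= c `^ q * x `^ (- p + q) by rewrite mulr_ge0 ?powR_ge0.
  move/(ler_wpM2l cx); rewrite powRM ?(ltW c0) ?(ltW x0) // !mulrA.
  suff -> : c `^ q * x `^ (- p + q) * c `^ (- q) * x `^ (- q) = X by [].
  rewrite (mulrAC (c `^ q)) -powRD ?subrr ?powRr0; last by rewrite (gt_eqF c0) implybT.
  by rewrite mul1r -powRD ?addrK // (gt_eqF x0) implybT.
have y_tangent : L * (X * (1 + p - p * (y / x))) <= L * Y.
  have [->|Ln0] := eqVneq L 0; first by rewrite !mul0r.
  have Lp : 0 < L by rewrite lt_neqAle eq_sym Ln0.
  by rewrite ler_pM2l // powRN_tangent ?y0 // ltW.
have k0 : 0 <= q / (p + 1) by rewrite divr_ge0 // ltW.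
rewrite -subr_ge0.
set P := c `^ q * (x `^ (- p + q) * a `^ (- q)) in a_tangent.
have -> : c `^ q * (l * x `^ (- p + q) * a `^ (- q)) = l * P.
  by rewrite /P; ring.
(* The slack is [l] times the first tangent gap plus [q / (p + 1)] times the
   second one. *)
have -> : l * P - q / (p + 1) * ((L + l) * X - L * Y) - l * X =
    l * (P - X * (1 + q - q * (a / (c * x))))
    + q / (p + 1) * (L * Y - L * (X * (1 + p - p * (y / x)))).
  have -> : a = ((L + l) * x - L * y) / l.
    by rewrite mean; field; rewrite gt_eqF.
  by rewrite /c; field; rewrite !gt_eqF.
by rewrite addr_ge0 // mulr_ge0 ?subr_ge0 // ltW.
Qed.

Theorem theorem2 (R : realType) (p q : R) (a lam : nat -> R)
  (hq : 0 < q) (hpq : q <= p)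
  (ha : forall n : nat, (1 <= n)%N -> 0 < a n)
  (hlam : forall n : nat, (1 <= n)%N -> 0 < lam n)
  (N : nat) (hN : (1 <= N)%N) :
  \sum_(1 <= n < N.+1) lam n * (wA lam a n / Lambda lam n) `^ (- p)
  <= ((p + 1) / p) `^ q
       * (\sum_(1 <= n < N.+1)
            lam n * (wA lam a n / Lambda lam n) `^ (- p + q) * (a n) `^ (- q))
     - q / (p + 1) * Lambda lam N * (wA lam a N / Lambda lam N) `^ (- p).
Proof.
have p0 : 0 < p by apply: lt_le_trans hpq.
have LambdaS n : Lambda lam n.+1 = Lambda lam n + lam n.+1.
  by rewrite /Lambda big_nat_recr.
have wAS n : wA lam a n.+1 = wA lam a n + lam n.+1 * a n.+1.
  by rewrite /wA big_nat_recr.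
have Lambda0 : Lambda lam 0 = 0 by rewrite /Lambda big_geq.
have wA0 : wA lam a 0 = 0 by rewrite /wA big_geq.
have Lambda_ge0 n : 0 <= Lambda lam n.
  by elim: n => [|n IH]; rewrite ?Lambda0 // LambdaS addr_ge0 // ltW ?hlam.
have LambdaS_gt0 n : 0 < Lambda lam n.+1 by rewrite LambdaS ltr_wpDl ?hlam.
have wA_ge0 n : 0 <= wA lam a n.
  elim: n => [|n IH]; first by rewrite wA0.
  by rewrite wAS addr_ge0 // mulr_ge0 // ltW ?hlam ?ha.
have wAS_gt0 n : 0 < wA lam a n.+1.
  by rewrite wAS ltr_wpDl // mulr_gt0 ?hlam ?ha.
(* Both sides vanish at [N = 0], which makes the induction start for free. *)
elim: N {hN} => [|n IH]; first
  by rewrite !big_geq // Lambda0 !(mulr0, mul0r, subr0).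
rewrite big_nat_recr //= (big_nat_recr n.+1) //=.
have mean_gt0 : 0 < Lambda lam n -> 0 < wA lam a n / Lambda lam n.
  case: n {IH} => [|n] L0; first by rewrite Lambda0 ltxx in L0.
  by rewrite divr_gt0.
have mean : (Lambda lam n + lam n.+1) * (wA lam a n.+1 / Lambda lam n.+1) =
    Lambda lam n * (wA lam a n / Lambda lam n) + lam n.+1 * a n.+1.
  rewrite -LambdaS mulrC divfK ?gt_eqF // wAS; congr (_ + _).
  case: n {IH mean_gt0} => [|n]; first by rewrite Lambda0 wA0 mul0r.
  by rewrite mulrC divfK ?gt_eqF.
have := @weighted_mean_step R p q _ _ _ _ _ p0 hq
  (divr_gt0 (wAS_gt0 n) (LambdaS_gt0 n)) (ha n.+1 isT) (Lambda_ge0 n)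
  (hlam n.+1 isT) mean_gt0 mean.
rewrite -LambdaS.
by move: IH; lra.
Qed.
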